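(* Let $M^3\subset\mathbb{R}^5$ be a singular $3$-manifold with a corank $1$ singularity at $p\in M^3$. Then the curvature locus of $M^3$ at $p$ is generated by the union of the curvature parabolas at $p$ of the singular surfaces in $\mathbb{R}^4$ given by the normal sections along the tangent directions of $M^3$ at $p$. That is, denoting by $\Delta_{cv}(M^3,p)\subset N_pM^3$ the curvature locus of $M^3$ at $p$ and, for each non-zero $w\in T_pM^3$, by $M^2_w$ the normal section of $M^3$ along $w$ and by $\Delta_p(M^2_w)$ its curvature parabola at $p$, $$\Delta_{cv}(M^3,p)=\bigcup_{w\in T_pM^3\setminus\{0\}}\Delta_p(M^2_w).$$
   Context: Corank $1$ manifolds. A singular corank $1$ $n$-manifold $M\subset\mathbb{R}^m$ at $p$ (here $(n,m)=(3,5)$ or $(2,4)$) is the image of a smooth map $g:\tilde M\to\mathbb{R}^m$, where $\tilde M$ is a smooth $n$-manifold and $q\in\tilde M$, $g(q)=p$, is a point at which $dg_q$ has rank $n-1$. Put $T_pM=\mathrm{Im}\,dg_q$ (dimension $n-1$) and $N_pM=(T_pM)^\perp\subset T_p\mathbb{R}^m$. The first fundamental form is $I(u,v)=\langle dg_q(u),dg_q(v)\rangle$ on $T_q\tilde M$ (a pseudo-metric). With local coordinates $(x_1,\dots,x_n)$ of $\tilde M$ at $q$ and $f$ the map $g$ in these coordinates, the second fundamental form $II:T_q\tilde M\times T_q\tilde M\to N_pM$ is the symmetric bilinear map with $II(\partial_{x_i},\partial_{x_j})=\pi_2(f_{x_ix_j})$ evaluated at the point corresponding to $q$, where $\pi_2:T_p\mathbb{R}^m\to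 N_pM$ is the orthogonal projection. Let $C_q=\{u\in T_q\tilde M: I(u,u)=1\}$ and $\eta(u)=II(u,u)$. The set $\eta(C_q)\subset N_pM$ is called the curvature locus $\Delta_{cv}$ when $n=3$, and the curvature parabola $\Delta_p$ when $n=2$ (it may degenerate to a half-line, a line or a point). Normal section: for non-zero $w\in T_pM^3$ let $\{w=0\}$ be the affine hyperplane of $\mathbb{R}^5$ through $p$ orthogonal to $w$. The normal section of $M^3$ along $w$ is $M^2_w=M^3\cap\{w=0\}$, understood as the image of the restriction of $g$ to the regular surface $g^{-1}(\{w=0\})$ near $q$; it is a corank $1$ surface at $p$ in $\{w=0\}\cong\mathbb{R}^4$. Its normal space at $p$ inside $\{w=0\}$ is identified with $N_pM^3$, so its curvature parabola is regarded as a subset of $N_pM^3$. *)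

(* Defs.v *)
From HB Require Import structures.
From mathcomp Require Import all_boot all_order all_algebra.
From mathcomp Require Import all_classical all_reals all_analysis.
Set Implicit Arguments.
Unset Strict Implicit.
Unset Printing Implicit Defensive.
Import Order.TTheory GRing.Theory Num.Theory.
Import numFieldNormedType.Exports.
Local Open Scope classical_set_scope.
Local Open Scope ring_scope.

(* Points and vectors of R^n are row vectors 'rV[R]_n; a linear subspace of
   R^m is the row space of a matrix. In particular the row space of the
   Jacobian 'J f x, with u *m 'J f x = 'd f x u, is the image of 'd f x. *)

Fixpoint Ck (R : realType) (n m : nat) (k : nat) (U : set 'rV[R]_n)
    (f : 'rV[R]_n -> 'rV[R]_m) : Prop :=
  match k with
  | 0 => forall x, U x -> {for x, continuous f}
  | k'.+1 => (forall x, U x -> differentiable f x) /\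
             (forall v, Ck k' U (fun x => 'D_v f x))
  end.

(* Only meaningful for U open. *)
Definition smooth_on (R : realType) (n m : nat) (U : set 'rV[R]_n)
    (f : 'rV[R]_n -> 'rV[R]_m) : Prop :=
  forall k, Ck k U f.

(* [chart_map] and [chart_inv] are total functions; only their values on
   [chart_dom] and on [chart_map @` chart_dom] matter. *)
Record chart (R : realType) (n : nat) (T : topologicalType) := Chart {
  chart_dom : set T;
  chart_map : T -> 'rV[R]_n;
  chart_inv : 'rV[R]_n -> T;
  chart_dom_open : open chart_dom;
  chart_cod_open : open (chart_map @` chart_dom);
  chart_map_continuous : {within chart_dom, continuous chart_map};
  chart_inv_continuous :
    {within chart_map @` chart_dom, continuous chart_inv};
  chart_mapK : forall x, chart_dom x -> chart_inv (chart_map x) = x }.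

Definition chart_cod (R : realType) (n : nat) (T : topologicalType)
    (c : chart R n T) : set 'rV[R]_n :=
  chart_map c @` chart_dom c.

Definition smooth_transition (R : realType) (n : nat) (T : topologicalType)
    (c c' : chart R n T) : Prop :=
  smooth_on (chart_map c @` (chart_dom c `&` chart_dom c'))
            (chart_map c' \o chart_inv c).

(* The atlas is maximal, so that its members are all the systems of local
   coordinates of the manifold. *)
Record smooth_manifold (R : realType) (n : nat) := SmoothManifold {
  carrier :> topologicalType;
  carrier_hausdorff : hausdorff_space carrier;
  carrier_second_countable : @second_countable carrier;
  atlas : set (chart R n carrier);
  atlas_cover : forall x : carrier, exists2 c, atlas c & chart_dom c x;
  atlas_compatible : forall c c', atlas c -> atlas c' -> smooth_transition c c';
  atlas_maximal : forall c,
    (forall c', atlas c' -> smooth_transition c c' /\ smooth_transition c' c) ->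
    atlas c }.

Definition smooth_map (R : realType) (n m : nat) (M : smooth_manifold R n)
    (g : M -> 'rV[R]_m) : Prop :=
  forall c, atlas c -> smooth_on (chart_cod c) (g \o chart_inv c).

(* phi, defined on the open set V, parametrizes regularly a neighbourhood of
   q in the subset S of M: it is a smooth immersion and a homeomorphism onto
   a relatively open subset of S, and phi t0 = q. *)
Definition local_parametrization (R : realType) (n k : nat)
    (M : smooth_manifold R n) (S : set M) (q : M)
    (V : set 'rV[R]_k) (phi : 'rV[R]_k -> M) (t0 : 'rV[R]_k) : Prop :=
  [/\ [/\ open V, V t0 & phi t0 = q],
      {within V, continuous phi},
      forall c, atlas c ->
        smooth_on (V `&` phi @^-1` chart_dom c) (chart_map c \o phi),
      forall c t, atlas c -> V t -> chart_dom c (phi t) ->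
        \rank ('J (chart_map c \o phi) t) = k &
      (exists2 W : set M, open W & phi @` V = S `&` W) /\
      exists2 psi : M -> 'rV[R]_k,
        forall t, V t -> psi (phi t) = t & {within phi @` V, continuous psi}].

Definition dotv (R : realType) (m : nat) (u v : 'rV[R]_m) : R :=
  (u *m v^T) 0 0.

Definition orth (R : realType) (m n : nat) (A : 'M[R]_(n, m)) : 'M[R]_m :=
  kermx A^T.

Definition orth_proj (R : realType) (m : nat) (A : 'M[R]_m) (z : 'rV[R]_m) :
    'rV[R]_m :=
  z *m proj_mx A (orth A).

Definition corank1 (R : realType) (n m : nat)
    (f : 'rV[R]_n -> 'rV[R]_m) (x : 'rV[R]_n) : Prop :=
  \rank ('J f x) = n.-1.

Definition tangent_space (R : realType) (n m : nat)
    (f : 'rV[R]_n -> 'rV[R]_m) (x : 'rV[R]_n) : 'M[R]_m :=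
  <<'J f x>>%MS.

(* E is the direction of the affine subspace of R^m in which the image of f
   is considered, and the normal space is taken inside E: E = 1%:M for a
   submanifold of R^m, and E = orth w for a section contained in the
   hyperplane {w = 0}. *)
Definition normal_space (R : realType) (n m : nat) (E : 'M[R]_m)
    (f : 'rV[R]_n -> 'rV[R]_m) (x : 'rV[R]_n) : 'M[R]_m :=
  (E :&: orth (tangent_space f x))%MS.

Definition first_form (R : realType) (n m : nat)
    (f : 'rV[R]_n -> 'rV[R]_m) (x u v : 'rV[R]_n) : R :=
  dotv ('d f x u) ('d f x v).

Definition second_form (R : realType) (n m : nat) (E : 'M[R]_m)
    (f : 'rV[R]_n -> 'rV[R]_m) (x u v : 'rV[R]_n) : 'rV[R]_m :=
  \sum_(i < n) \sum_(j < n) (u 0 i * v 0 j) *: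
    orth_proj (normal_space E f x)
      ('D_(delta_mx 0 i) (fun y => 'D_(delta_mx 0 j) f y) x).

Definition curvature_locus (R : realType) (n m : nat) (E : 'M[R]_m)
    (f : 'rV[R]_n -> 'rV[R]_m) (x : 'rV[R]_n) : set 'rV[R]_m :=
  [set second_form E f x u u | u in [set u | first_form f x u u = 1]].

(* The preimage under g of the hyperplane {w = 0} through g q. *)
Definition section_preimage (R : realType) (n m : nat)
    (M : smooth_manifold R n) (g : M -> 'rV[R]_m) (q : M) (w : 'rV[R]_m) :
    set M :=
  [set x | dotv (g x - g q) w = 0].

(* The curvature locus of the restriction of g to the surface
   [section_preimage g q w], computed in local coordinates phi of that surface
   at q. The locus does not depend on the choice of phi, so quantifying phi
   existentially amounts to using any one of them. *)
Definition curvature_parabola (R : realType) (n m : nat)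
    (M : smooth_manifold R n) (g : M -> 'rV[R]_m) (q : M) (w : 'rV[R]_m) :
    set 'rV[R]_m :=
  [set y | exists (V : set 'rV[R]_2) (phi : 'rV[R]_2 -> M) (t0 : 'rV[R]_2),
     local_parametrization (section_preimage g q w) q V phi t0 /\
     curvature_locus (orth w) (g \o phi) t0 y].

(* Main.v *)
Require Import Defs.
From HB Require Import structures.
From mathcomp Require Import all_boot all_order all_algebra.
From mathcomp Require Import all_classical all_reals all_analysis.
From mathcomp Require Import zify ring lra.
Set Implicit Arguments.
Unset Strict Implicit.
Unset Printing Implicit Defensive.
Import Order.TTheory GRing.Theory Num.Theory.
Import numFieldNormedType.Exports.
Local Open Scope classical_set_scope.
Local Open Scope ring_scope.

(* Let f be g in the chart c, a the coordinates of q, J = 'J f a, and let psi be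
   the coordinate expression of a parametrization of the section by {w = 0}.
   Since <f o psi - f a, w> = 0 and w is a nonzero tangent vector, the image of
   'd psi is the plane {u | <u J, w> = 0}. Moreover T_pM is spanned by w and the
   tangent space of the section, so both normal spaces coincide, and
   (f o psi)''(v, v) = f''(u, u) + psi''(v, v) J with u = 'd psi v, whose last
   term is tangent: the fundamental forms of the section are the restrictions
   of those of M. Finally every unit u lies in such a plane, because the
   2-dimensional space T_pM contains a nonzero w orthogonal to u J. The section
   is a surface by the implicit function theorem, applied to <f - g q, w>,
   whose derivative in any direction e with e J = w is |w|^2 > 0. *)

(** * Functions of class C^k *)

(** Uniqueness of the differential identifies ['d f x] with the candidate [L]. This form suits the
    implicit function, whose differential is obtained from an explicit estimate. *)
Lemma differentiable_epsP (R : realType) (V W : normedModType R) (f : V -> W)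
    (x : V) (L : {linear V -> W}) : continuous L ->
  (forall e, 0 < e ->
    \forall y \near x, `|f y - f x - L (y - x)| <= e * `|y - x|) ->
  differentiable f x /\ 'd f x = L :> (V -> W).
Proof.
move=> cL fL.
suff H : f \o shift x = cst (f x) + L +o_ 0 id.
  by split; [apply/diff_locallyP|]; rewrite (diff_unique cL H).
apply/eqaddoP => e e0.
rewrite [\forall x \near _, _ <= _](near_shift x) sub0r; near=> y.
rewrite /= [leLHS](_ : _ = `|f y - f x - L (y - x)|); first by near: y; exact: fL.
by rewrite !fctE /= subrK opprD addrA.
Unshelve. all: by end_near. Qed.

Lemma differentiable_eps (R : realType) (V W : normedModType R) (f : V -> W)
    (x : V) (e : R) : differentiable f x -> 0 < e ->
  \forall y \near x, `|f y - f x - 'd f x (y - x)| <= e * `|y - x|.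
Proof.
move=> /diff_locally /eqaddoP H e0; have {H} := H _ e0.
rewrite [\forall x \near _, _ <= _](near_shift x) sub0r.
by apply: filterS => y; rewrite /= !fctE /= subrK opprD addrA.
Qed.

Lemma near_eq_differentiable (R : realType) (V W : normedModType R)
    (f g : V -> W) (x : V) :
  (\near x, f x = g x) -> differentiable f x -> differentiable g x.
Proof.
move=> fg df; apply: (proj1 (@differentiable_epsP _ _ _ _ _ ('d f x) _ _)) => [|e e0].
  exact: diff_continuous.
near=> y; rewrite -(near fg y) // -(nbhs_singleton fg).
by near: y; exact: differentiable_eps.
Unshelve. all: by end_near. Qed.

(* [Ck] with an arbitrary codomain, so that scalar functions are covered too. *)
Fixpoint ck (R : realType) (V W : normedModType R) (k : nat) (U : set V)
    (f : V -> W) : Prop :=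
  match k with
  | 0 => forall x, U x -> {for x, continuous f}
  | k'.+1 => (forall x, U x -> differentiable f x) /\
             (forall v, ck k' U (fun x => 'D_v f x))
  end.

Lemma CkE (R : realType) n m k (U : set 'rV[R]_n) (f : 'rV[R]_n -> 'rV[R]_m) :
  Ck k U f <-> ck k U f.
Proof.
by elim: k f => //= k IH f; split=> -[fd fk]; split=> // v; apply/IH.
Qed.

Section ck_theory.
Context {R : realType}.
Implicit Types V W : normedModType R.

Lemma ckS V W k (U : set V) (f : V -> W) : ck k.+1 U f -> ck k U f.
Proof.
elim: k f => [|k IH] f [fd fk].
  by move=> x Ux; apply/differentiable_continuous/fd.
by split=> // v; apply: IH.
Qed.

Lemma ck_sub V W k (U U' : set V) (f : V -> W) : U' `<=` U -> ck k U f -> ck k U' f.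
Proof.
move=> UU'; elim: k f => /= [|k IH] f; first by move=> cf x /UU'/cf.
by move=> [fd fk]; split => [x /UU'/fd//|v]; exact: IH.
Qed.

Lemma ck_continuous V W k (U : set V) (f : V -> W) x :
  ck k U f -> U x -> {for x, continuous f}.
Proof. by elim: k => [|k IH]; [exact | move=> /ckS]. Qed.

(** Since [U] is open, equality on [U] is equality near each of its points, so all iterated
    derivatives agree there. This allows derivative formulas valid only on [U] to be used in
    inductions on [k]. *)
Lemma ck_eq V W k (U : set V) (f g : V -> W) : open U ->
  (forall x, U x -> f x = g x) -> ck k U f -> ck k U g.
Proof.
move=> oU; elim: k f g => [|k IH] f g fg.
  move=> /= cf x Ux; have fgx : \near x, f x = g x.
    by near=> y; apply: fg; near: y; exact: open_nbhs_nbhs.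
  rewrite /prop_for /continuous_at -(fg x Ux).
  by apply: cvg_trans (cf x Ux); apply: near_eq_cvg.
move=> [fd fk].
have fgn x : U x -> \near x, f x = g x.
  by move=> Ux; near=> y; apply: fg; near: y; exact: open_nbhs_nbhs.
split=> [x Ux|v]; first by apply: near_eq_differentiable (fd x Ux); exact: fgn.
apply: IH (fk v) => x Ux; apply: near_eq_derive; exact: fgn.
Unshelve. all: by end_near. Qed.

Lemma ck_cst V W k (U : set V) (c : W) : ck k U (fun _ => c).
Proof.
elim: k c => [|k IH] c /=; first by move=> x _; exact: cvg_cst.
split => [x _|v]; first exact: differentiable_cst.
have -> : (fun x => 'D_v (fun _ => c) x) = (fun _ => 0 : W).
  by apply/funext => x; exact: derive_cst.
exact: IH.
Qed.

Lemma ck_id V k (U : set V) : ck k U id.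
Proof.
case: k => [x _|k]; first exact: cvg_id.
split => [x _|v]; first exact: ex_diff.
have -> : (fun x => 'D_v id x) = (fun _ => v) by apply/funext => x; exact: derive_id.
exact: ck_cst.
Qed.

Lemma ckD V W k (U : set V) (f g : V -> W) : open U ->
  ck k U f -> ck k U g -> ck k U (fun x => f x + g x).
Proof.
move=> oU; elim: k f g => [|k IH] f g.
  by move=> /= cf cg x Ux; apply: cvgD; [exact: cf | exact: cg].
move=> [fd fk] [gd gk]; split=> [x Ux|v].
  exact: differentiableD (fd x Ux) (gd x Ux).
apply: ck_eq (IH _ _ (fk v) (gk v)) => // x Ux.
by rewrite -deriveD //; apply: diff_derivable; [exact: fd | exact: gd].
Qed.

Lemma ck_sum V W k (U : set V) n (f : 'I_n -> V -> W) : open U ->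
  (forall i, ck k U (f i)) -> ck k U (fun x => \sum_i f i x).
Proof.
move=> oU; elim: n f => [|n IH] f fk.
  by apply: ck_eq (ck_cst _ _ 0) => // x _; rewrite big_ord0.
apply: ck_eq (ckD oU (IH (fun i => f (widen_ord (leqnSn n) i)) _) (fk ord_max)) => //.
by move=> x _; rewrite big_ord_recr.
Qed.

Lemma ckM V k (U : set V) (f g : V -> R) : open U ->
  ck k U f -> ck k U g -> ck k U (fun x => f x * g x).
Proof.
move=> oU; elim: k f g => [|k IH] f g.
  by move=> /= cf cg x Ux; apply: cvgM; [exact: cf | exact: cg].
move=> fk1 gk1; move: (fk1) (gk1) => [fd fk] [gd gk]; split=> [x Ux|v].
  exact: differentiableM (fd x Ux) (gd x Ux).
apply: ck_eq (ckD oU (IH _ _ (ckS fk1) (gk v)) (IH _ _ (ckS gk1) (fk v))) => // x Ux.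
by rewrite -deriveM //; apply: diff_derivable; [exact: fd | exact: gd].
Qed.

(** The derivative is [- f^-1 * f^-1 * 'D_v f], where [f^-1] recurs with one degree of regularity
    less: the induction feeds on itself. *)
Lemma ckV V k (U : set V) (f : V -> R) : open U -> (forall x, U x -> f x != 0) ->
  ck k U f -> ck k U (fun x => (f x)^-1).
Proof.
move=> oU f0; elim: k => [|k IH].
  by move=> /= cf x Ux; apply: cvgV; [exact: f0 | exact: cf].
move=> fk1; move: (fk1) => [fd fk]; split=> [x Ux|v].
  by apply: differentiableV; [exact: fd | exact: f0].
have fVk := IH (ckS fk1).
have := ckM oU (ck_cst k U (-1 : R)) (ckM oU (ckM oU fVk fVk) (fk v)).
apply: ck_eq => // x Ux.
rewrite deriveV ?f0 //; last exact/diff_derivable/fd.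
by rewrite /GRing.scale /= expr2 invfM mulN1r mulNr.
Qed.

Lemma derive_linear_comp V W W' (L : {linear W -> W'}) (f : V -> W) x v :
  continuous L -> differentiable f x -> 'D_v (fun y => L (f y)) x = L ('D_v f x).
Proof.
move=> cL df; have dL y : differentiable L y by exact: linear_differentiable.
rewrite [LHS](deriveE _ (differentiable_comp df (dL (f x)))).
by rewrite (diff_comp df (dL (f x))) /= diff_lin // deriveE.
Qed.

Lemma ck_linear V W W' k (U : set V) (L : {linear W -> W'}) (f : V -> W) :
  open U -> continuous L -> ck k U f -> ck k U (fun x => L (f x)).
Proof.
move=> oU cL; elim: k f => [|k IH] f.
  by move=> cf x Ux; apply: continuous_comp; [exact: cf | exact: cL].
move=> [fd fk]; split=> [x Ux|v].
  by apply: differentiable_comp; [exact: fd | exact: linear_differentiable].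
apply: ck_eq (IH _ (fk v)) => // x Ux.
by rewrite derive_linear_comp //; exact: fd.
Qed.

Lemma linear_coord m n i j : linear (fun M : 'M[R]_(m, n) => M i j).
Proof. by move=> a u v; rewrite !mxE. Qed.

Definition coord_lin m n i j : {linear 'M[R]_(m, n) -> R} :=
  HB.pack (fun M : 'M[R]_(m, n) => M i j)
    (GRing.isLinear.Build _ _ _ _ _ (@linear_coord m n i j)).

Lemma linear_scalel W (w : W) : linear (fun a : R => a *: w).
Proof. by move=> a u v; rewrite scalerDl scalerA. Qed.

Definition scalel_lin W (w : W) : {linear R -> W} :=
  HB.pack (fun a : R => a *: w) (GRing.isLinear.Build _ _ _ _ _ (linear_scalel w)).

Lemma ck_coord V k (U : set V) n (f : V -> 'rV[R]_n) i : open U ->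
  ck k U f -> ck k U (fun x => f x 0 i).
Proof.
by move=> oU; apply: (ck_linear (L := coord_lin 0 i)) => //; exact: coord_continuous.
Qed.

Lemma ck_scalel V W k (U : set V) (s : V -> R) (w : W) : open U ->
  ck k U s -> ck k U (fun x => s x *: w).
Proof.
by move=> oU; apply: (ck_linear (L := scalel_lin w)) => //; exact: scalel_continuous.
Qed.

Lemma ck_row V k (U : set V) n (f : V -> 'rV[R]_n) : open U ->
  (forall i, ck k U (fun x => f x 0 i)) -> ck k U f.
Proof.
move=> oU fk; have := ck_sum oU (fun i => ck_scalel (delta_mx 0 i : 'rV[R]_n) oU (fk i)).
by move=> H; refine (ck_eq oU _ H) => x _; rewrite [RHS]row_sum_delta.
Qed.

(** In finite dimension [L] is a finite sum of coordinates times constant vectors; [ck 0] is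
    continuity, so the closure lemmas apply. *)
Lemma linear_row_continuous n W (L : {linear 'rV[R]_n -> W}) : continuous L.
Proof.
have H : ck 0 setT (fun x : 'rV[R]_n => \sum_i x 0 i *: L (delta_mx 0 i)).
  apply: ck_sum openT _ => i; apply: ck_scalel openT _; apply: ck_coord openT _.
  exact: ck_id.
suff cL : ck 0 setT L by move=> x; exact: cL.
refine (ck_eq openT _ H) => y _.
by rewrite [in RHS](row_sum_delta y) linear_sum; apply: eq_bigr => i _; rewrite linearZ.
Qed.

Lemma derive_comp V W n (f : V -> 'rV[R]_n) (g : 'rV[R]_n -> W) x v :
  differentiable f x -> differentiable g (f x) ->
  'D_v (g \o f) x = \sum_j ('D_v f x) 0 j *: 'D_(delta_mx 0 j) g (f x).
Proof.
move=> df dg; rewrite (deriveE _ (differentiable_comp df dg)) (diff_comp df dg).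
rewrite deriveE // /= [in LHS](row_sum_delta ('d f x v)) linear_sum.
by apply: eq_bigr => j _; rewrite linearZ deriveE.
Qed.

(** By the chain rule in coordinates, a derivative of [g \o f] is a sum of products of a coordinate
    of ['D_v f] with a partial derivative of [g] composed with [f]. With [g] scalar, [ckM] handles
    these products; the induction is over all [g]. *)
Lemma ck_comp_real V n k (U : set V) (U' : set 'rV[R]_n) (f : V -> 'rV[R]_n)
    (g : 'rV[R]_n -> R) : open U -> (forall x, U x -> U' (f x)) ->
  ck k U f -> ck k U' g -> ck k U (g \o f).
Proof.
move=> oU UU'; elim: k g => [|k IH] g.
  by move=> cf cg x Ux; apply: continuous_comp; [exact: cf | exact/cg/UU'].
move=> fk1 gk1; move: (fk1) (gk1) => [fd fk] [gd gk]; split=> [x Ux|v].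
  by apply: differentiable_comp; [exact: fd | exact/gd/UU'].
have H := ck_sum oU (fun j => ckM oU (ck_coord j oU (fk v))
   (IH _ (ckS fk1) (gk (delta_mx 0 j)))).
apply: ck_eq H => // x Ux; rewrite derive_comp //; [exact: fd | exact/gd/UU'].
Qed.

Lemma ck_comp V n m k (U : set V) (U' : set 'rV[R]_n) (f : V -> 'rV[R]_n)
    (g : 'rV[R]_n -> 'rV[R]_m) : open U -> (forall x, U x -> U' (f x)) ->
  open U' -> ck k U f -> ck k U' g -> ck k U (g \o f).
Proof.
move=> oU UU' oU' fk gk; apply: ck_row => // i.
exact: (ck_comp_real oU UU' fk (ck_coord i oU' gk)).
Qed.

Lemma ck_mulmx V k (U : set V) n m (f : V -> 'rV[R]_n) (B : 'M[R]_(n, m)) :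
  open U -> ck k U f -> ck k U (fun x => f x *m B).
Proof.
move=> oU; apply: (ck_linear (L := mulmxr B)) => //; exact: linear_row_continuous.
Qed.

Lemma mulmxr_differentiable n m (B : 'M[R]_(n, m)) (x : 'rV[R]_n) :
  differentiable (mulmxr B) x.
Proof. apply: linear_differentiable; exact: linear_row_continuous. Qed.

Lemma derive_mulmx V n m (f : V -> 'rV[R]_n)
    (B : 'M[R]_(n, m)) x v :
  differentiable f x -> 'D_v (fun y => f y *m B) x = 'D_v f x *m B.
Proof.
move=> df; apply: (derive_linear_comp (L := mulmxr B) v _ df).
exact: linear_row_continuous.
Qed.

End ck_theory.

(** * Implicit functions *)

Section implicit_function.
Context {R : realType} {n k : nat}.
Context (U : set 'rV[R]_n) (h : 'rV[R]_n -> R) (a e : 'rV[R]_n) (B : 'M[R]_(k, n)).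
Context (oU : open U) (Ua : U a) (h_ck : forall j, ck j U h).
Context (ha : h a = 0) (hea : 0 < 'D_e h a).

(** The zero set of [h] near [a] is sought as a graph [z = s t] in these coordinates. *)
Let X (t : 'rV[R]_k) (z : R) : 'rV[R]_n := a + t *m B + z *: e.

Let lipB : exists2 K, 0 < K & forall t : 'rV[R]_k, `|t *m B| <= K * `|t|.
Proof.
have [K K0 KB] := linear_lipschitz (linear_row_continuous (L := mulmxr B)).
by exists K.
Qed.

Let h_diff x : U x -> differentiable h x.
Proof. by case: (h_ck 1) => + _; exact. Qed.

Let hD_cont v x : U x -> {for x, continuous (fun y => 'D_v h y)}.
Proof. by case: (h_ck 1) => _ /(_ v); exact. Qed.

Let X_cont2 (s : 'rV[R]_k -> R) (t : 'rV[R]_k) : {for t, continuous s} ->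
  {for t, continuous (fun t => X t (s t))}.
Proof.
move=> cs.
have cB : {for t, continuous (fun t : 'rV[R]_k => t *m B)}.
  exact: (linear_row_continuous (L := mulmxr B)).
have ce : {for t, continuous (fun t : 'rV[R]_k => s t *: e)}.
  exact: (continuous_comp cs (@scalel_continuous _ _ e _)).
exact: (cvgD (cvgD (cvg_cst a) cB) ce).
Qed.

Let box : exists2 r, 0 < r &
  forall t z, `|t| <= r -> `|z| <= r -> U (X t z) /\ 0 < 'D_e h (X t z).
Proof.
have : \near a, U a /\ 0 < 'D_e h a.
  near=> x; split; near: x; first exact: open_nbhs_nbhs.
  exact: (cvgr_gt _ (hD_cont (v := e) Ua)).
move=> /nbhs_normP [d /= d0 dP].
have [K K0 KB] := lipB.
have Ke : 0 < K + `|e| + 1 by rewrite ltr_wpDl // addr_ge0 // ltW.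
(* The displacement from [a] is at most [K + |e|] times this radius; the added 1 makes it strictly
   less than [d] and the denominator positive. *)
exists (d / (K + `|e| + 1)) => [|t z tr zr]; first exact: divr_gt0.
apply: dP; rewrite /= /X opprD addrA opprD addrA subrr sub0r -opprD normrN.
apply: (@le_lt_trans _ _ ((K + `|e|) * (d / (K + `|e| + 1)))).
  rewrite mulrDl (le_trans (ler_normD _ _)) // lerD //.
    by rewrite (le_trans (KB t)) // ler_pM2l.
  by rewrite normrZ mulrC ler_wpM2l.
by rewrite mulrCA gtr_pMr // ltr_pdivrMr // mul1r ltrDl.
Unshelve. all: by end_near. Qed.

Let hX_derive t z : U (X t z) ->
  is_derive z 1 (fun z => h (X t z)) ('D_e h (X t z)).
Proof.
move=> UX.
have dX : is_diff z (X t) (fun z => z *: e).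
  have : is_diff z (cst (a + t *m B) + (fun z : R => z *: e)) (0 + (fun z => z *: e)).
    exact: is_diffD.
  by rewrite add0r.
have dX' : differentiable (X t) z by exact: ex_diff.
have dh := h_diff UX.
have dhX : differentiable (h \o X t) z by exact: differentiable_comp.
split; first exact: (@diff_derivable _ _ _ (h \o X t)).
rewrite -[LHS]/('D_1 (h \o X t) z) (deriveE _ dhX) (diff_comp dX' dh) /=.
by rewrite [X in 'd h _ (X _)]diff_val scale1r deriveE.
Qed.

(** For small [t], the function [h (X t z)] is strictly increasing in [z] on [[-r, r]] and changes
    sign there, so it has exactly one zero [s t]. Continuity, differentiability and higher
    regularity of [s] are then proved in this order. *)
Lemma implicit_function : exists r rho (s : 'rV[R]_k -> R), [/\ 0 < r, 0 < rho,
  forall t, ball 0 rho t ->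
    [/\ `|s t| < r, U (X t (s t)), 0 < 'D_e h (X t (s t)) & h (X t (s t)) = 0],
  forall t z, ball 0 rho t -> `|z| < r -> h (X t z) = 0 -> z = s t &
  forall j, ck j (ball 0 rho) s].
Proof.
have [r r0 rP] := box; have [K K0 KB] := lipB.
have inc (t : 'rV[R]_k) z1 z2 : `|t| <= r -> `|z1| <= r -> `|z2| <= r -> z1 < z2 ->
    h (X t z1) < h (X t z2).
  rewrite !ler_norml => tr /andP[z1r _] /andP[_ z2r] z12.
  have zin z : z1 <= z <= z2 -> `|z| <= r by rewrite ler_norml; lra.
  have dz z : z1 <= z <= z2 -> is_derive z 1 (fun z => h (X t z)) ('D_e h (X t z)).
    by move=> /zin zr; apply: hX_derive; case: (rP t z tr zr).
  have [|||c] := @MVT _ (fun z => h (X t z)) (fun z => 'D_e h (X t z)) z1 z2 => //.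
  - by move=> z; rewrite in_itv /= => /andP[? ?]; apply: dz; rewrite !ltW.
  - by apply: derivable_within_continuous => z; rewrite in_itv /= => /dz[].
  rewrite in_itv /= => /andP[c1 c2] hc; rewrite -subr_gt0 hc mulr_gt0 ?subr_gt0 //.
  by apply: (rP t c _ _).2 => //; apply: zin; rewrite !ltW.
have ler_inc (t : 'rV[R]_k) z1 z2 : `|t| <= r -> `|z1| <= r -> `|z2| <= r -> z1 <= z2 ->
    h (X t z1) <= h (X t z2).
  by move=> ? ? ?; rewrite le_eqVlt => /predU1P[-> //|?]; exact/ltW/inc.
have hX_cont z (t : 'rV[R]_k) : `|t| <= r -> `|z| <= r ->
    {for t, continuous (fun t => h (X t z))}.
  move=> tr zr; apply: (continuous_comp (f := X^~ z) (g := h)).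
    by apply: (@X_cont2 (fun=> z) t); exact: (@cst_continuous _ _ z t).
  exact/differentiable_continuous/h_diff/(rP t z tr zr).1.
have X00 : X 0 0 = a by rewrite /X mul0mx scale0r !addr0.
have n0 : `|0 : 'rV[R]_k| <= r by rewrite normr0 ltW.
have nr : `|r| <= r by rewrite ger0_norm // ltW.
have nNr : `|- r| <= r by rewrite normrN.
have nr0 : `|0 : R| <= r by rewrite normr0 ltW.
have hr : 0 < h (X 0 r) by rewrite -[X in X < _]ha -X00; apply: inc.
have hNr : h (X 0 (- r)) < 0 by rewrite -[X in _ < X]ha -X00; apply: inc; rewrite ?oppr_lt0.
(* The signs at the two ends hold for [t = 0] and persist by continuity; this determines [rho]. *)
have : \forall t \near (0 : 'rV[R]_k), `|t| <= r /\ h (X t (- r)) < 0 < h (X t r).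
  near=> t; split.
    near: t; apply: filterS (nbhsx_ballx (0 : 'rV[R]_k) r r0) => t.
    by rewrite -ball_normE /= sub0r normrN => /ltW.
  apply/andP; split; near: t.
    exact: (cvgr_lt _ (hX_cont (- r) 0 n0 nNr)).
  exact: (cvgr_gt _ (hX_cont r 0 n0 nr)).
move=> /nbhs_ballP [rho /= rho0 rhoP].
(* Membership in the ball is put inside the existential so that [choice] yields a total function,
   with arbitrary values outside the ball. *)
have ex_s (t : 'rV[R]_k) : exists z, ball 0 rho t -> `|z| < r /\ h (X t z) = 0.
  have [bt|] := pselect (ball 0 rho t); last by exists 0.
  have [tr /andP[hlo hhi]] := rhoP t bt.
  have [|||z] := @IVT _ (fun z => h (X t z)) (- r) r 0.
  - by lra.
  - apply: derivable_within_continuous => z; rewrite in_itv /= -ler_norml => zr.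
    by have [] := hX_derive (rP t z tr zr).1.
  - by rewrite ge_min le_max (ltW hlo) (ltW hhi) orbT.
  rewrite in_itv /= => /andP[z1 z2] hz; exists z => _; split=> //.
  rewrite ltr_norml !lt_neqAle z1 z2 !andbT; apply/andP; split.
    by apply: contraTneq hlo => ->; rewrite hz ltxx.
  by apply: contraTneq hhi => <-; rewrite hz ltxx.
have [s sP] := choice ex_s.
have uniq_s (t : 'rV[R]_k) z : ball 0 rho t -> `|z| < r -> h (X t z) = 0 -> z = s t.
  move=> bt zr hz; have [sr hs] := sP t bt; have [tr _] := rhoP t bt.
  case: (ltgtP z (s t)) => // zs.
    by have := inc t _ _ tr (ltW zr) (ltW sr) zs; rewrite hz hs ltxx.
  by have := inc t _ _ tr (ltW sr) (ltW zr) zs; rewrite hz hs ltxx.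
have bnbhs (t : 'rV[R]_k) : ball 0 rho t -> nbhs t (ball 0 rho).
  by move=> bt; apply: open_nbhs_nbhs; split => //; exact: ball_open.
have s_cont (t : 'rV[R]_k) : ball 0 rho t -> {for t, continuous s}.
  move=> bt; apply: (@cvgrPdist_lt R R 'rV[R]_k (nbhs t) _ s (s t)).2 => eps eps0.
  have [sr hs] := sP t bt; have [tr _] := rhoP t bt.
  (* With this [d], both [s t - d] and [s t + d] stay in the box and within [eps] of [s t]. The
     signs of [h] at these two heights persist for [t'] near [t], and monotonicity traps [s t']
     between them. *)
  pose d := Num.min (eps / 2) ((r - `|s t|) / 2).
  have d0 : 0 < d by rewrite lt_min !divr_gt0 ?subr_gt0.
  have deps : d < eps by rewrite gt_min; apply/orP; left; lra.
  have dr : d < r - `|s t| by rewrite gt_min; apply/orP; right; lra.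
  have sdr : `|s t + d| <= r.
    by rewrite (le_trans (ler_normD _ _)) // (gtr0_norm d0); lra.
  have sNdr : `|s t - d| <= r.
    by rewrite (le_trans (ler_normB _ _)) // (gtr0_norm d0); lra.
  have lo : h (X t (s t - d)) < 0 by rewrite -hs; apply: inc tr _ (ltW sr) _; rewrite ?gtrBl.
  have hi : 0 < h (X t (s t + d)) by rewrite -hs; apply: inc tr (ltW sr) _ _; rewrite ?ltrDl.
  near=> t'.
  have bt' : ball 0 rho t' by near: t'; exact: bnbhs.
  have lo' : h (X t' (s t - d)) < 0.
    by near: t'; exact: (cvgr_lt _ (hX_cont (s t - d) t tr sNdr)).
  have hi' : 0 < h (X t' (s t + d)).
    by near: t'; exact: (cvgr_gt _ (hX_cont (s t + d) t tr sdr)).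
  have [sr' hs'] := sP t' bt'; have [tr' _] := rhoP t' bt'.
  have lo'' : s t - d < s t'.
    rewrite ltNge; apply: contraTN lo' => H.
    by rewrite -leNgt -hs'; apply: ler_inc => //; exact: ltW.
  have hi'' : s t' < s t + d.
    rewrite ltNge; apply: contraTN hi' => H.
    by rewrite -leNgt -hs'; apply: ler_inc => //; exact: ltW.
  by rewrite ltr_norml; lra.
have s_diff (t : 'rV[R]_k) : ball 0 rho t -> differentiable s t /\
    forall v, 'D_v s t = - 'D_(v *m B) h (X t (s t)) * ('D_e h (X t (s t)))^-1.
  move=> bt; have [sr hs] := sP t bt; have [tr _] := rhoP t bt.
  have [UX c0] := rP t (s t) tr (ltW sr).
  have dh := h_diff UX; set x := X t (s t) in UX c0 dh hs *.
  pose A (v : 'rV[R]_n) : R := 'd h x v.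
  have AD u v : A (u + v) = A u + A v by exact: linearD.
  have AZ (b : R) v : A (b *: v) = b * A v by exact: linearZ.
  pose c : R := 'D_e h x; rewrite -/c in c0 *.
  have Ae : A e = c by rewrite /c deriveE.
  have linL : linear (fun v : 'rV[R]_k => - A (v *m B) * c^-1 : R).
    by move=> u v w; rewrite mulmxDl -scalemxAl AD AZ /GRing.scale /=; ring.
  (* The candidate differential, found by formally differentiating [h (X t (s t)) = 0]. *)
  pose L : {linear 'rV[R]_k -> R} :=
    HB.pack (fun v : 'rV[R]_k => - A (v *m B) * c^-1 : R)
      (GRing.isLinear.Build _ _ _ _ _ linL).
  have cL : continuous L by exact: linear_row_continuous.
  have [M M0 LM] := linear_lipschitz cL.
  have [|ds dsE] := @differentiable_epsP _ _ _ s t L cL; last first.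
    by split=> // v; rewrite !deriveE // dsE.
  move=> eps eps0.
  have W0 : 0 < K + `|e| * M + 1 by rewrite ltr_wpDl // addr_ge0 ?mulr_ge0 // ltW.
  have e10 : 0 < `|e| + 1 by rewrite ltr_wpDl.
  (* The error tolerance for [h]. The first bound gives [q * |e| <= 1/2], so that the error of [s]
     can be absorbed on the left; the second makes the remaining terms at most [eps / 2] times
     [|t' - t|]. *)
  pose q := Num.min ((`|e| + 1)^-1 / 2) (eps / 2 / (K + `|e| * M + 1)).
  have q0 : 0 < q by rewrite lt_min !divr_gt0 ?invr_gt0.
  have q1 : q <= (`|e| + 1)^-1 / 2 by rewrite ge_min lexx.
  have q2 : q <= eps / 2 / (K + `|e| * M + 1) by rewrite ge_min lexx orbT.
  have qe : q * `|e| <= 1 / 2.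
    apply: (@le_trans _ _ ((`|e| + 1)^-1 / 2 * (`|e| + 1))).
      by apply: ler_pM (ltW q0) _ q1 _ => //; rewrite lerDl.
    by rewrite mulrAC mulVf ?gt_eqF.
  have qK : q * (K + `|e| * M) <= eps / 2.
    apply: (@le_trans _ _ (eps / 2 / (K + `|e| * M + 1) * (K + `|e| * M + 1))).
      apply: ler_pM (ltW q0) _ q2 _; last by rewrite lerDl.
      by apply: addr_ge0 (ltW K0) (mulr_ge0 _ (ltW M0)).
    by rewrite divfK ?gt_eqF.
  near=> t'.
  have bt' : ball 0 rho t' by near: t'; exact: bnbhs.
  have [sr' hs'] := sP t' bt'.
  have : `|h (X t' (s t')) - h x - 'd h x (X t' (s t') - x)| <= q * c * `|X t' (s t') - x|.
    near: t'.
    exact: (X_cont2 (s_cont t bt)) (differentiable_eps dh (mulr_gt0 q0 c0)).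
  have -> : X t' (s t') - x = (t' - t) *m B + (s t' - s t) *: e.
    rewrite /x /X mulmxBl scalerBl -!addrA [in RHS]addrCA.
    rewrite !opprD; apply/eqP; rewrite -subr_eq0; apply/eqP.
    by apply/rowP => i; rewrite !mxE; ring.
  rewrite -/(A _) hs' hs subrr sub0r normrN AD AZ Ae.
  (* As [h] vanishes at both points, the linear part alone is the error of [h], and it equals [c]
     times the error of [s]. *)
  rewrite (_ : A _ + _ = c * (s t' - s t - L (t' - t))); last first.
    by rewrite /= /GRing.scale /=; field; rewrite gt_eqF.
  rewrite normrM (gtr0_norm c0) [q * c]mulrC -mulrA ler_pM2l //.
  set D := s t' - s t - L (t' - t); set T := t' - t => H.
  have H1 : `|T *m B + (s t' - s t) *: e| <= K * `|T| + (`|D| + M * `|T|) * `|e|.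
    rewrite (le_trans (ler_normD _ _)) // lerD // normrZ ler_wpM2r //.
    have -> : s t' - s t = D + L T by rewrite /D subrK.
    by rewrite (le_trans (ler_normD _ _)) // lerD.
  have {}H := le_trans H (ler_wpM2l (ltW q0) H1).
  have H2 := ler_wpM2r (normr_ge0 T) qK.
  have H3 := ler_wpM2r (normr_ge0 D) qe.
  (* The three bounds combine to [|D| <= eps / 2 * |T| + |D| / 2]. *)
  by nra.
have s_ck j : ck j (ball 0 rho) s.
  elim: j => [|j IH]; first by move=> t; exact: s_cont.
  (* 'D_v s is a quotient of derivatives of h at X t (s t): regularity improves. *)
  split=> [t /s_diff[]//|v].
  have oV : open (ball (0 : 'rV[R]_k) rho) by exact: ball_open.
  have Xck : ck j (ball 0 rho) (fun t => X t (s t)).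
    apply: ckD => //; last exact: ck_scalel.
    by apply: ckD => //; [exact: ck_cst | apply: ck_mulmx => //; exact: ck_id].
  have XU t : ball 0 rho t -> U (X t (s t)).
    by move=> bt; apply: (rP _ _ _ _).1; [case: (rhoP t bt) | case: (sP t bt) => /ltW].
  have Dck v' : ck j (ball 0 rho) (fun t => 'D_v' h (X t (s t))).
    by have [_ hk] := h_ck j.+1; exact: (ck_comp_real oV XU Xck (hk v')).
  have c0 t : ball 0 rho t -> 'D_e h (X t (s t)) != 0.
    move=> bt; rewrite gt_eqF //; apply: (rP _ _ _ _).2; first by case: (rhoP t bt).
    by case: (sP t bt) => /ltW.
  have H := ckM oV (ck_cst j _ (-1 : R)) (ckM oV (Dck (v *m B)) (ckV oV c0 (Dck e))).
  refine (ck_eq oV _ H) => t bt.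
  by rewrite (s_diff t bt).2 mulN1r mulNr.
exists r, rho, s; split => // t bt.
have [sr hs] := sP t bt; have [tr _] := rhoP t bt.
by have [] := rP t (s t) tr (ltW sr).
Unshelve. all: by end_near. Qed.

End implicit_function.

(** * Orthogonal projections and normal spaces *)

Section orthogonal.
Context {R : realType}.

Lemma dotvE m (u v : 'rV[R]_m) : dotv u v = \sum_i u 0 i * v 0 i.
Proof. by rewrite /dotv mxE; apply: eq_bigr => i _; rewrite mxE. Qed.

Lemma dotvC m (u v : 'rV[R]_m) : dotv u v = dotv v u.
Proof. by rewrite !dotvE; apply: eq_bigr => i _; rewrite mulrC. Qed.

Lemma dotvDl m (u u' v : 'rV[R]_m) : dotv (u + u') v = dotv u v + dotv u' v.
Proof. by rewrite /dotv mulmxDl mxE. Qed.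

Lemma dotvZl m c (u v : 'rV[R]_m) : dotv (c *: u) v = c * dotv u v.
Proof. by rewrite /dotv -scalemxAl mxE. Qed.

Lemma dotv_gt0 m (u : 'rV[R]_m) : u != 0 -> 0 < dotv u u.
Proof.
move=> /rV0Pn[i ui]; rewrite dotvE (bigD1 i) //= ltr_pwDl //.
  by rewrite -expr2 exprn_even_gt0.
by apply: sumr_ge0 => j _; rewrite -expr2 sqr_ge0.
Qed.

Lemma mul_tr_eq0 m (u v : 'rV[R]_m) : (u *m v^T == 0) = (dotv u v == 0).
Proof.
apply/eqP/eqP => [H|H]; first by rewrite /dotv H mxE.
by apply/rowP => i; rewrite ord1 [RHS]mxE.
Qed.

Lemma sub_orth m n (A : 'M[R]_(n, m)) p (z : 'M[R]_(p, m)) :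
  (z <= orth A)%MS = (z *m A^T == 0).
Proof. by apply/sub_kermxP/eqP. Qed.

(** Each row of [z] is orthogonal to the row space of [A], hence to itself, and the dot product is
    positive definite. *)
Lemma orth_sub0 m n (A : 'M[R]_(n, m)) p (z : 'M[R]_(p, m)) :
  (z <= A)%MS -> (z <= orth A)%MS -> z = 0.
Proof.
rewrite sub_orth => /submxP[D ->] /eqP H.
apply/row_matrixP => i; rewrite row0.
apply/eqP; apply: contraT => /dotv_gt0; set x := row i _.
suff : x *m x^T == 0 by rewrite mul_tr_eq0 => /eqP ->; rewrite ltxx.
rewrite {2}/x row_mul trmx_mul mulmxA /x [row i (D *m A) *m _](_ : _ = 0) ?mul0mx //.
by rewrite -row_mul H row0.
Qed.

Lemma capmx_orth m (A : 'M[R]_m) : (A :&: orth A = 0)%MS.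
Proof. by apply: (@orth_sub0 _ _ A); [exact: capmxSl | exact: capmxSr]. Qed.

(** The sum is direct, and the ranks of [A] and [orth A] add up to [m]. *)
Lemma addsmx_orth m (A : 'M[R]_m) : (1%:M <= A + orth A)%MS.
Proof.
rewrite sub1mx -col_leq_rank.
have /mxdirect_addsP/mxdirectP /= -> := capmx_orth A.
by rewrite mxrank_ker mxrank_tr subnKC // rank_leq_row.
Qed.

Lemma orth_proj_sub m (A : 'M[R]_m) z : (orth_proj A z <= A)%MS.
Proof. exact: proj_mx_sub. Qed.

Lemma sub_orth_proj m (A : 'M[R]_m) z : (z - orth_proj A z <= orth A)%MS.
Proof.
apply: proj_mx_compl_sub; apply: submx_trans (addsmx_orth A); exact: submx1.
Qed.

(** Two candidates differ by a vector lying both in [A] and in [orth A]. All later computations of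
    projections go through this characterization. *)
Lemma orth_proj_unique m (A : 'M[R]_m) z x :
  (x <= A)%MS -> (z - x <= orth A)%MS -> orth_proj A z = x.
Proof.
move=> xA zxA; apply/eqP; rewrite -subr_eq0; apply/eqP.
apply: (@orth_sub0 _ _ A).
  by rewrite addmx_sub ?orth_proj_sub // eqmx_opp.
rewrite (_ : _ - _ = (z - x) - (z - orth_proj A z)).
  by rewrite addmx_sub // eqmx_opp sub_orth_proj.
by rewrite opprB [RHS]addrC addrA subrK.
Qed.

(** Normal spaces are compared as row spaces only, whereas [orth_proj] takes a matrix; this makes
    the projection independent of the matrix chosen. *)
Lemma orth_proj_eqmx m (A B : 'M[R]_m) z :
  (A :=: B)%MS -> orth_proj A z = orth_proj B z.
Proof.
move=> AB; apply: orth_proj_unique; first by rewrite AB orth_proj_sub.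
have := sub_orth_proj B z; rewrite !sub_orth => /eqP H.
have /submxP[D ->] : (A <= B)%MS by rewrite AB.
by rewrite trmx_mul mulmxA H mul0mx.
Qed.

Lemma orth_projD m (A : 'M[R]_m) z z' :
  orth_proj A (z + z') = orth_proj A z + orth_proj A z'.
Proof. exact: mulmxDl. Qed.

Lemma orth_projZ m (A : 'M[R]_m) c z : orth_proj A (c *: z) = c *: orth_proj A z.
Proof. by rewrite /orth_proj scalemxAl. Qed.

Lemma orth_proj_sum m (A : 'M[R]_m) n (z : 'I_n -> 'rV[R]_m) :
  orth_proj A (\sum_i z i) = \sum_i orth_proj A (z i).
Proof. by rewrite /orth_proj mulmx_suml. Qed.

Lemma orth_proj_eq0 m (A : 'M[R]_m) z : (z <= orth A)%MS -> orth_proj A z = 0.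
Proof. by move=> zA; apply: orth_proj_unique; rewrite ?sub0mx ?subr0. Qed.

Lemma orthS m n p (A : 'M[R]_(n, m)) (B : 'M[R]_(p, m)) :
  (A <= B)%MS -> (orth B <= orth A)%MS.
Proof.
move=> /submxP[D ->]; rewrite sub_orth trmx_mul mulmxA.
by have /eqP -> : orth B *m B^T == 0; rewrite ?mul0mx // -sub_orth.
Qed.

(* A vector of the row space of J is, modulo a multiple of w, in that of P *m J. *)
Lemma normal_space_section m n k (J : 'M[R]_(n, m)) (P : 'M[R]_(k, n))
    (w : 'rV[R]_m) :
  w != 0 -> (w <= J)%MS -> (P :=: kermx (J *m w^T))%MS ->
  (orth w :&: orth <<P *m J>> :=: 1%:M :&: orth <<J>>)%MS.
Proof.
move=> w0 wJ PK; apply/eqmxP; apply/andP; split; last first.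
  rewrite cap1mx sub_capmx; apply/andP; split.
    by apply: orthS; rewrite genmxE.
  by apply: orthS; rewrite !genmxE submxMl.
rewrite cap1mx; apply/row_subP => i; set z := row i _.
have : (z <= orth w :&: orth <<P *m J>>)%MS by exact: row_sub.
rewrite sub_capmx => /andP[zw zPJ].
have {}zPJ : (z <= orth (P *m J))%MS.
  by apply: submx_trans zPJ _; apply: orthS; rewrite genmxE.
suff : (z <= orth J)%MS.
  by move=> /submx_trans; apply; apply: orthS; rewrite genmxE.
move: zw zPJ; rewrite !sub_orth mul_tr_eq0 => /eqP zw /eqP zPJ.
suff : J *m z^T == 0 by rewrite -trmx_eq0 trmx_mul trmxK.
apply/eqP/row_matrixP => l; rewrite row0 row_mul; apply/eqP.
rewrite mul_tr_eq0; apply/eqP; set x := row l J.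
pose c := dotv x w / dotv w w.
have /submxP[b wE] := wJ.
have dw := dotv_gt0 w0.
(* The coefficient [c] is chosen so that [x - c w] is orthogonal to [w]; its preimage then lies in
   the kernel spanned by [P]. *)
have : (delta_mx 0 l - c *: b <= P)%MS.
  rewrite PK; apply/sub_kermxP; rewrite mulmxA mulmxBl -scalemxAl -rowE -wE -/x.
  apply/eqP; rewrite mul_tr_eq0 dotvDl -scaleNr dotvZl mulNr /c divfK ?subrr //.
  by rewrite gt_eqF.
move=> /submxP[v vE].
have xE : x = c *: w + v *m P *m J.
  by rewrite -vE mulmxBl -scalemxAl -rowE -wE addrC subrK.
rewrite xE dotvDl dotvZl [dotv w z]dotvC zw mulr0 add0r dotvC.
by rewrite /dotv -mulmxA trmx_mul mulmxA zPJ mul0mx mxE.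
Qed.

End orthogonal.

(** * Second derivatives and second fundamental forms *)

Section second_derivative.
Context {R : realType}.

Lemma mul_jacobian n m (f : 'rV[R]_n -> 'rV[R]_m) x v : v *m 'J f x = 'd f x v.
Proof. by rewrite /jacobian mul_rV_lin1. Qed.

Lemma jacobian_comp n m p (f : 'rV[R]_n -> 'rV[R]_m) (g : 'rV[R]_m -> 'rV[R]_p) x :
  differentiable f x -> differentiable g (f x) ->
  'J (g \o f) x = 'J f x *m 'J g (f x).
Proof.
move=> df dg; apply/row_matrixP => i.
by rewrite row_mul !rowE !mul_jacobian (diff_comp df dg).
Qed.

Lemma near_eq_jacobian n m (f g : 'rV[R]_n -> 'rV[R]_m) x :
  (\near x, f x = g x) -> differentiable f x -> 'J f x = 'J g x.
Proof.
move=> fg df; apply/row_matrixP => i; rewrite [LHS]rowE [RHS]rowE.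
have dg := near_eq_differentiable fg df.
apply: etrans (esym (deriveEjacobian _ df)) _.
apply: etrans (near_eq_derive _ fg) _.
exact: deriveEjacobian.
Qed.

Lemma jacobian_mulmx n m (B : 'M[R]_(n, m)) x : 'J (mulmxr B) x = B.
Proof.
apply/row_matrixP => i; rewrite [LHS]rowE [RHS]rowE mul_jacobian.
rewrite diff_lin; [by [] | exact: linear_row_continuous].
Qed.

Lemma derive_scalel (V W : normedModType R) (s : V -> R) (w : W) x v :
  differentiable s x -> 'D_v (fun y => s y *: w) x = 'D_v s x *: w.
Proof.
move=> ds; rewrite (deriveE _ ds).
apply: etrans (deriveE _ (differentiableZl w ds)) _.
by rewrite (diffZl w ds).
Qed.

(** Splitting into coordinates reduces the product rule for a scalar times a vector function to the
    scalar one. *)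
Lemma scale_row_sum (V : Type) n (s : V -> R) (F : V -> 'rV[R]_n) :
  (fun y => s y *: F y) = \sum_i (fun y => (s y * F y 0 i) *: delta_mx 0 i).
Proof.
apply/funext => y; rewrite fct_sumE [LHS]row_sum_delta.
by apply: eq_bigr => i _; rewrite mxE.
Qed.

Lemma differentiable_row_coord (V : normedModType R) n (F : V -> 'rV[R]_n) x i :
  differentiable F x -> differentiable (fun y => F y 0 i) x.
Proof. by move=> dF; exact: (differentiable_comp dF (differentiable_coord _ _ _)). Qed.

Lemma differentiable_scale (V : normedModType R) n (s : V -> R) (F : V -> 'rV[R]_n) x :
  differentiable s x -> differentiable F x ->
  differentiable (fun y => s y *: F y) x.
Proof.
move=> ds dF; rewrite scale_row_sum; apply: differentiable_sum => i.
apply: differentiableZl.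
exact: (differentiableM ds (differentiable_row_coord i dF)).
Qed.

Lemma derive_row_coord (V : normedModType R) n (F : V -> 'rV[R]_n) x v i :
  differentiable F x -> 'D_v (fun y => F y 0 i) x = ('D_v F x) 0 i.
Proof.
move=> dF; apply: (derive_linear_comp (L := coord_lin 0 i)) dF.
exact: coord_continuous.
Qed.

Lemma derive_scale (V : normedModType R) n (s : V -> R) (F : V -> 'rV[R]_n) x v :
  differentiable s x -> differentiable F x ->
  'D_v (fun y => s y *: F y) x = 'D_v s x *: F x + s x *: 'D_v F x.
Proof.
move=> ds dF; have dFi i := differentiable_row_coord i dF.
have dsF i : differentiable (fun y => s y * F y 0 i) x.
  exact: (differentiableM ds (dFi i)).
rewrite scale_row_sum derive_sum; last first.
  by move=> i; apply: diff_derivable; exact: differentiableZl.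
rewrite [RHS]row_sum_delta; apply: eq_bigr => i _.
rewrite (derive_scalel _ _ (dsF i)); congr (_ *: _).
apply: etrans (deriveM (diff_derivable ds) (diff_derivable (dFi i))) _.
rewrite (derive_row_coord v i dF) !mxE /GRing.scale /=.
by rewrite addrC [F x 0 i * _]mulrC.
Qed.

Lemma derive_deltaE n (W : normedModType R) (f : 'rV[R]_n -> W) x v :
  differentiable f x -> 'D_v f x = \sum_j v 0 j *: 'D_(delta_mx 0 j) f x.
Proof.
move=> df; rewrite deriveE // [in LHS](row_sum_delta v) linear_sum.
by apply: eq_bigr => j _; rewrite linearZ deriveE.
Qed.

(** The right-hand side is the double sum of [second_form] before projection, so the coordinate
    definition becomes a second derivative along a single vector. *)
Lemma derive_derive_deltaE n m (U : set 'rV[R]_n) (f : 'rV[R]_n -> 'rV[R]_m) x v :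
  open U -> U x -> ck 2 U f ->
  'D_v (fun y => 'D_v f y) x = \sum_i \sum_j (v 0 i * v 0 j) *:
     'D_(delta_mx 0 i) (fun y => 'D_(delta_mx 0 j) f y) x.
Proof.
move=> oU Ux [fd fk].
have dfk u : differentiable (fun y => 'D_u f y) x by have [+ _] := fk u; exact.
pose G j y := v 0 j *: 'D_(delta_mx 0 j) f y.
have -> : 'D_v (fun y => 'D_v f y) x = 'D_v (\sum_j G j) x.
  apply: near_eq_derive; near=> y.
  have Uy : U y by near: y; exact: open_nbhs_nbhs.
  by rewrite fct_sumE (derive_deltaE v (fd y Uy)).
rewrite derive_sum; last first.
  by move=> j; apply: derivableZ; exact: diff_derivable.
rewrite exchange_big /=; apply: eq_bigr => j _.
rewrite [LHS](deriveZ _ (diff_derivable (v := v) (dfk _))).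
rewrite (derive_deltaE v (dfk _)) scaler_sumr; apply: eq_bigr => i _.
by rewrite scalerA mulrC.
Unshelve. all: by end_near. Qed.

(** Near [t] the first derivative is a sum of products, coordinates of ['D_v psi] times partial
    derivatives of [f]. Differentiating the second factors gives the Hessian of [f] along [u];
    differentiating the first gives a combination of rows of the Jacobian, that is, a tangent
    vector. *)
Lemma derive_derive_comp n m k (V : set 'rV[R]_k) (U : set 'rV[R]_n)
    (f : 'rV[R]_n -> 'rV[R]_m) (psi : 'rV[R]_k -> 'rV[R]_n) t v :
  open V -> V t -> (forall t, V t -> U (psi t)) -> open U ->
  ck 2 V psi -> ck 2 U f ->
  let u := 'D_v psi t in
  'D_v (fun s => 'D_v (f \o psi) s) t =
    'D_u (fun y => 'D_u f y) (psi t) + 'D_v (fun s => 'D_v psi s) t *m 'J f (psi t).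
Proof.
move=> oV Vt VU oU psi2 f2 u; rewrite (derive_derive_deltaE u oU (VU _ Vt) f2).
case: psi2 f2 => psid psik [fd fk].
have dpsik : differentiable (fun s => 'D_v psi s) t by have [+ _] := psik v; exact.
have dfk j : differentiable (fun y => 'D_(delta_mx 0 j) f y) (psi t).
  by have [+ _] := fk (delta_mx 0 j : 'rV[R]_n); apply; exact: VU.
pose s j y : R := ('D_v psi y) 0 j.
pose F j y := 'D_(delta_mx 0 j) f (psi y).
have ds j : differentiable (s j) t.
  exact: (differentiable_row_coord j dpsik).
have dF j : differentiable (F j) t.
  exact: (differentiable_comp (psid _ Vt) (dfk j)).
pose G j y := s j y *: F j y.
have -> : 'D_v (fun s => 'D_v (f \o psi) s) t = 'D_v (\sum_j G j) t.
  apply: near_eq_derive; near=> y.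
  have Vy : V y by near: y; exact: open_nbhs_nbhs.
  by rewrite fct_sumE (derive_comp v (psid y Vy) (fd _ (VU _ Vy))).
rewrite derive_sum; last first.
  by move=> j; apply: diff_derivable; exact: differentiable_scale (ds j) (dF j).
rewrite [in RHS]exchange_big /= mul_jacobian [X in 'd f _ X]row_sum_delta linear_sum.
rewrite -big_split /=; apply: eq_bigr => j _.
rewrite (derive_scale v (ds j) (dF j)) addrC; congr (_ + _).
  rewrite linearZ /s (derive_row_coord v j dpsik); congr (_ *: _).
  exact: deriveE (fd _ (VU _ Vt)).
apply: etrans (congr1 _ (derive_comp v (psid _ Vt) (dfk j))) _.
rewrite scaler_sumr; apply: eq_bigr => i _.
by rewrite scalerA mulrC.
Unshelve. all: by end_near. Qed.

(* Qualified because MathComp-Analysis has a topological [normal_space]. *)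
Lemma second_formE n m (E : 'M[R]_m) (U : set 'rV[R]_n) (f : 'rV[R]_n -> 'rV[R]_m) x v :
  open U -> U x -> ck 2 U f ->
  second_form E f x v v =
    orth_proj (Defs.normal_space E f x) ('D_v (fun y => 'D_v f y) x).
Proof.
move=> oU Ux f2; rewrite (derive_derive_deltaE v oU Ux f2) orth_proj_sum.
apply: eq_bigr => i _; rewrite orth_proj_sum; apply: eq_bigr => j _.
by rewrite orth_projZ.
Qed.

End second_derivative.

(** * Tangent plane and fundamental forms of a section *)

Section section_of_corank1.
Context {R : realType} {n m k : nat}.

(** The inclusion of [P] in the kernel is an equality by dimension: if [w = b J], then [b] sends
    [J *m w^T] to [|w|^2], so this column has rank 1 and its kernel has dimension [n - 1]. *)
Lemma kermx_section (J : 'M[R]_(n, m)) (P : 'M[R]_(k, n)) (w : 'rV[R]_m) :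
  w != 0 -> (w <= J)%MS -> P *m J *m w^T = 0 -> k = n.-1 -> \rank P = k ->
  (P :=: kermx (J *m w^T))%MS.
Proof.
move=> w0 /submxP[b wE] PJw kn rP; apply/eqmxP.
have PK : (P <= kermx (J *m w^T))%MS by apply/sub_kermxP; rewrite mulmxA.
rewrite -(mxrank_leqif_eq PK) rP mxrank_ker kn.
suff -> : \rank (J *m w^T) = 1%N by rewrite subn1.
apply/eqP; rewrite eqn_leq rank_leq_col lt0n mxrank_eq0 /=.
apply: contraTneq (dotv_gt0 w0) => H.
by rewrite /dotv {1}wE -mulmxA H mulmx0 mxE ltxx.
Qed.

Context (U : set 'rV[R]_n) (f : 'rV[R]_n -> 'rV[R]_m) (V : set 'rV[R]_k)
  (psi : 'rV[R]_k -> 'rV[R]_n) (F : 'rV[R]_k -> 'rV[R]_m) (t0 : 'rV[R]_k)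
  (w : 'rV[R]_m).

(** The function [f \o psi] paired with [w] is constant on [V]; its Jacobian, given by the chain
    rule, is therefore zero, and the rank of ['J psi t0] does the rest. *)
Lemma section_tangent :
  open U -> open V -> V t0 -> (forall t, V t -> U (psi t)) ->
  ck 1 U f -> ck 1 V psi ->
  (forall t, V t -> dotv (f (psi t) - f (psi t0)) w = 0) ->
  \rank ('J psi t0) = k -> k = n.-1 -> w != 0 -> (w <= 'J f (psi t0))%MS ->
  ('J psi t0 :=: kermx ('J f (psi t0) *m w^T))%MS.
Proof.
move=> oU oV Vt0 VU [fd _] [psid _] fw rP kn w0 wJ.
apply: kermx_section => //.
have df := fd _ (VU _ Vt0); have dpsi := psid _ Vt0.
have dfpsi := differentiable_comp dpsi df.
have dw : differentiable (mulmxr w^T) (f (psi t0)).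
  exact: mulmxr_differentiable.
have := jacobian_comp dfpsi dw.
rewrite jacobian_mulmx (jacobian_comp dpsi df) => <-.
have nc : \forall t \near t0, cst (f (psi t0) *m w^T) t = (mulmxr w^T \o (f \o psi)) t.
  near=> t; have Vt : V t by near: t; exact: open_nbhs_nbhs.
  have /eqP := fw t Vt; rewrite -mul_tr_eq0 mulmxBl subr_eq0 => /eqP <-.
  by [].
rewrite -(near_eq_jacobian nc (differentiable_cst _ _)).
apply/row_matrixP => i; rewrite [LHS]rowE mul_jacobian row0.
by rewrite diff_cst.
Unshelve. all: by end_near. Qed.

(** [F] stands for [g \o phi], which agrees with its expression [f \o psi] in a chart only where
    [phi] stays in the chart domain; hence the separate [F]. *)
Lemma section_forms v :
  open U -> open V -> V t0 -> (forall t, V t -> U (psi t)) ->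
  ck 2 U f -> ck 2 V psi -> (forall t, V t -> F t = f (psi t)) ->
  w != 0 -> (w <= 'J f (psi t0))%MS ->
  ('J psi t0 :=: kermx ('J f (psi t0) *m w^T))%MS ->
  let u := v *m 'J psi t0 in
  first_form F t0 v v = first_form f (psi t0) u u /\
  second_form (orth w) F t0 v v = second_form 1%:M f (psi t0) u u.
Proof.
move=> oU oV Vt0 VU f2 psi2 Ff w0 wJ PK u.
have Vn t : V t -> \near t, V t by move=> Vt; exact: open_nbhs_nbhs.
have [fd _] := f2; have [psid _] := psi2.
have df := fd _ (VU _ Vt0); have dpsi := psid _ Vt0.
have dfpsi := differentiable_comp dpsi df.
have FE t : V t -> \near t, (f \o psi) t = F t.
  by move=> Vt; near=> y; rewrite Ff //; near: y; exact: Vn.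
have JE : 'J F t0 = 'J psi t0 *m 'J f (psi t0).
  by rewrite -(near_eq_jacobian (FE _ Vt0) dfpsi) (jacobian_comp dpsi df).
have uE : u = 'D_v psi t0 by rewrite (deriveEjacobian _ dpsi).
split; first by rewrite /first_form -!mul_jacobian JE mulmxA.
have F2 : ck 2 V F.
  apply: (ck_eq oV (f := f \o psi)) => [t Vt|]; first by rewrite Ff.
  exact: (ck_comp oV VU oU psi2 f2).
rewrite (second_formE _ _ oV Vt0 F2) (second_formE _ _ oU (VU _ Vt0) f2).
have NE : (Defs.normal_space (orth w) F t0 :=: Defs.normal_space 1%:M f (psi t0))%MS.
  by rewrite /Defs.normal_space /tangent_space JE; exact: normal_space_section.
rewrite (orth_proj_eqmx _ NE).
have -> : 'D_v (fun t => 'D_v F t) t0 = 'D_v (fun t => 'D_v (f \o psi) t) t0.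
  apply: near_eq_derive; near=> t; apply: esym; apply: near_eq_derive.
  by apply: FE; near: t; exact: Vn.
rewrite (derive_derive_comp v oV Vt0 VU oU psi2 f2) -uE orth_projD.
(* The term containing the second derivative of [psi] is tangent, so it has no normal component. *)
rewrite [X in _ + X]orth_proj_eq0 ?addr0 //.
rewrite sub_orth.
have : (Defs.normal_space 1%:M f (psi t0) <= orth ('J f (psi t0)))%MS.
  apply: submx_trans (capmxSr _ _) _; apply: orthS; by rewrite genmxE.
rewrite sub_orth => /eqP H.
by rewrite -trmx_eq0 trmx_mul trmxK trmx_mul mulmxA H mul0mx.
Unshelve. all: by end_near. Qed.

End section_of_corank1.

(** * Parametrizations of normal sections *)

Lemma within_open_continuous (T S : topologicalType) (A : set T) (f : T -> S) x :
  open A -> {within A, continuous f} -> A x -> {for x, continuous f}.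
Proof.
by move=> oA; rewrite continuous_open_subspace // => + Ax; apply; rewrite inE.
Qed.

Lemma within_open_preimage (T S : topologicalType) (A : set T) (B : set S) (f : T -> S) :
  open A -> {within A, continuous f} -> open B -> open (A `&` f @^-1` B).
Proof.
move=> oA cf oB; rewrite openE => x [Ax Bfx]; apply: filterI.
  exact: open_nbhs_nbhs.
by apply: (within_open_continuous oA cf Ax); exact: open_nbhs_nbhs.
Qed.

Lemma comp_within_continuous (T S Z : topologicalType) (A : set T)
    (f : T -> S) (h : S -> Z) :
  {within A, continuous f} -> continuous h -> {within A, continuous (h \o f)}.
Proof.
by move=> cf ch x; exact: (@continuous_comp (subspace A) S Z f h x (cf x) (ch _)).
Qed.

Section charts.
Context {R : realType} {n : nat} {T : topologicalType}.
Implicit Types c : chart R n T.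

Lemma chart_inv_dom c x : chart_cod c x -> chart_dom c (chart_inv c x).
Proof. by move=> [y cy <-]; rewrite chart_mapK. Qed.

Lemma chart_invK c x : chart_cod c x -> chart_map c (chart_inv c x) = x.
Proof. by move=> [y cy <-]; rewrite chart_mapK. Qed.

Lemma open_chart_overlap c c' : open (chart_map c @` (chart_dom c `&` chart_dom c')).
Proof.
rewrite (_ : _ @` _ = chart_cod c `&` chart_inv c @^-1` chart_dom c').
  apply: within_open_preimage; [exact: chart_cod_open | | exact: chart_dom_open].
  exact: chart_inv_continuous.
apply/seteqP; split=> [x [y [cy c'y] <-]|x [cx c'x]].
  by split; [exists y | rewrite /= chart_mapK].
exists (chart_inv c x); last exact: chart_invK.
by split=> //; exact: chart_inv_dom.
Qed.

End charts.

(** The rows of [B] complete [e] to a basis, and [P] and [Q] are the blocks of the inverse matrix: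
    [x *m P] and [x *m Q] are the coordinates of [x] along [B] and [e]. *)
Lemma row_complement (R : fieldType) k (e : 'rV[R]_(k + 1)) : e != 0 ->
  exists (B : 'M[R]_(k, k + 1)) (P : 'M[R]_(k + 1, k)) (Q : 'cV[R]_(k + 1)),
    [/\ B *m P = 1%:M, B *m Q = 0, e *m P = 0, e *m Q = 1%:M &
        P *m B + Q *m e = 1%:M].
Proof.
move=> e0.
have re : \rank e = 1%N by apply/eqP; rewrite eqn_leq rank_leq_row lt0n mxrank_eq0.
have rC : \rank (e^C)%MS = k by rewrite mxrank_compl re addnK.
have [B BE] : exists B : 'M[R]_(k, k + 1), (B :=: e^C)%MS.
  (* The number of rows of [row_base] is a rank, so the basis is generalized before that rank is
     rewritten to [k]. *)
  by move: (row_base _) (eq_row_base (e^C)%MS) => B; move: B; rewrite rC => B; exists B.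
have uC : col_mx B e \in unitmx.
  rewrite -row_full_unit -sub1mx -addsmxE addsmxC.
  have := addsmx_compl_full e; rewrite -sub1mx => /submx_trans; apply.
  by rewrite addsmxS // BE.
pose M := invmx (col_mx B e).
exists B, (lsubmx M), (rsubmx M).
have := mulmxV uC; have := mulVmx uC; rewrite -/M -{1 2}[M]hsubmxK.
rewrite mul_row_col => ->; rewrite mul_col_row scalar_mx_block.
by move=> /eq_block_mx[-> -> -> ->].
Qed.

Section section_parametrization.
Context {R : realType} {k m : nat} (M : smooth_manifold R (k + 1)).
Context (g : M -> 'rV[R]_m) (q : M) (c : chart R (k + 1) M) (w : 'rV[R]_m).
Context (g_smooth : smooth_map g) (c_atlas : atlas c) (q_c : chart_dom c q).

Let f := g \o chart_inv c.
Let a := chart_map c q.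

Let f_ck j : ck j (chart_cod c) f.
Proof. exact/CkE/g_smooth. Qed.

Let fa : f a = g q.
Proof. by rewrite /f /= chart_mapK. Qed.

Let cod_a : chart_cod c a.
Proof. by exists q. Qed.

Let oU : open (chart_cod c).
Proof. exact: chart_cod_open. Qed.

(** In the chart the section is the graph of the implicit function [s] over the directions [B], with
    [e] as vertical direction; reading off the [B]-coordinates inverts the parametrization. *)
Lemma section_local_parametrization : w != 0 -> (w <= 'J f a)%MS ->
  exists V phi t0, local_parametrization (k := k) (section_preimage g q w) q V phi t0.
Proof.
move=> w0 /submxP[e wE].
have e0 : e != 0 by apply: contraNneq w0 => e0; rewrite wE e0 mul0mx.
have [B [P [Q [BP BQ eP eQ PBQe]]]] := row_complement e0.
pose h x := dotv (f x - g q) w.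
have h_ck j : ck j (chart_cod c) h.
  apply: (ck_coord (f := fun x => (f x - g q) *m w^T)) => //.
  apply: ck_mulmx => //; apply: ckD => //; exact: ck_cst.
have df : differentiable f a by case: (f_ck 1) => + _; apply.
have ha : h a = 0 by rewrite /h fa subrr /dotv mul0mx mxE.
have hea : 0 < 'D_e h a.
  have -> : 'D_e h a = dotv w w; last exact: dotv_gt0.
  have -> : h = (fun x => ((f x - g q) *m w^T) 0 0) by [].
  have dfg : differentiable (fun x => f x - g q) a.
    exact: (differentiableB df (differentiable_cst _ _)).
  have dfw : differentiable (fun x => (f x - g q) *m w^T) a.
    exact: (differentiable_comp dfg (mulmxr_differentiable w^T _)).
  rewrite (derive_row_coord e 0 dfw) (derive_mulmx w^T e dfg).
  rewrite /dotv /=; congr (_ 0 0); congr (_ *m _).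
  rewrite [LHS]deriveB; [|exact: diff_derivable|exact: derivable_cst].
  by rewrite derive_cst subr0 deriveEjacobian.
have [r [rho [s [r0 rho0 sP s_uniq s_ck]]]] := implicit_function B oU cod_a h_ck ha hea.
pose X t := a + t *m B + s t *: e.
have b0 : ball (0 : 'rV[R]_k) rho 0 by exact: ballxx.
have oV : open (ball (0 : 'rV[R]_k) rho) by exact: ball_open.
have s0 : s 0 = 0.
  by apply/esym/s_uniq => //; rewrite ?normr0 // mul0mx scale0r !addr0.
have X0 : X 0 = a by rewrite /X mul0mx s0 scale0r !addr0.
have XU t : ball 0 rho t -> chart_cod c (X t) by move=> /sP[].
have X_ck j : ck j (ball 0 rho) X.
  apply: ckD => //; last exact: ck_scalel.
  by apply: ckD => //; [exact: ck_cst | apply: ck_mulmx => //; exact: ck_id].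
have Xa t : X t - a = t *m B + s t *: e by rewrite /X -(addrA a) [LHS]addrC addKr.
have XP t : (X t - a) *m P = t.
  rewrite Xa mulmxDl -mulmxA BP mulmx1.
  by rewrite -scalemxAl eP scaler0 addr0.
have XQ t : ((X t - a) *m Q) 0 0 = s t.
  rewrite Xa mulmxDl -mulmxA BQ mulmx0 add0r.
  by rewrite -scalemxAl eQ !mxE eqxx mulr1.
pose phi t := chart_inv c (X t).
have phi_dom t : ball 0 rho t -> chart_dom c (phi t) by move=> /XU; exact: chart_inv_dom.
have phiK t : ball 0 rho t -> chart_map c (phi t) = X t by move=> /XU; exact: chart_invK.
have phi_cont t : ball 0 rho t -> {for t, continuous phi}.
  move=> bt; apply: continuous_comp; first exact: ck_continuous (X_ck 0%N) bt.
  apply: within_open_continuous oU _ (XU t bt); exact: chart_inv_continuous.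
have phi_within : {within ball 0 rho, continuous phi}.
  by rewrite continuous_open_subspace // => t; rewrite inE => /phi_cont.
pose psi y := (chart_map c y - a) *m P.
have mulP_cont (j : nat) (N : 'M[R]_(k + 1, j)) :
    continuous (fun x : 'rV[R]_(k + 1) => (x - a) *m N).
  suff cN : ck 0 setT (fun x : 'rV[R]_(k + 1) => (x - a) *m N) by move=> x; exact: cN.
  exact: ck_mulmx openT (ckD openT (ck_id _ _) (ck_cst _ _ (- a))).
exists (ball 0 rho), phi, 0; split.
- by split => //; rewrite /phi X0 chart_mapK.
- exact: phi_within.
(* In another chart, [phi] reads as the transition map composed with the smooth map [X]. *)
- move=> c' c'_atlas j; apply/CkE.
  have tr := atlas_compatible c_atlas c'_atlas.
  apply: (ck_comp (U' := chart_map c @` (chart_dom c `&` chart_dom c')) (f := X)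
    (g := chart_map c' \o chart_inv c)).
  + exact: (within_open_preimage oV phi_within (chart_dom_open c')).
  + move=> t [bt c't]; exists (phi t); last exact: phiK.
    by split => //; exact: phi_dom.
  + exact: open_chart_overlap.
  + by apply: ck_sub (X_ck j) => t [].
  + exact/CkE/tr.
- move=> c' t c'_atlas bt c't.
  pose V' := ball (0 : 'rV[R]_k) rho `&` phi @^-1` chart_dom c'.
  have oV' : open V' by exact: (within_open_preimage oV phi_within (chart_dom_open c')).
  have tr : ck 1 (chart_map c @` (chart_dom c `&` chart_dom c'))
      (chart_map c' \o chart_inv c).
    exact/CkE/atlas_compatible.
  have tr' : ck 1 (chart_map c' @` (chart_dom c' `&` chart_dom c))
      (chart_map c \o chart_inv c').
    exact/CkE/atlas_compatible.
  pose G := chart_map c' \o phi; pose H := chart_map c \o chart_inv c'.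
  have dG : differentiable G t.
    apply: (differentiable_comp (f := X) (g := chart_map c' \o chart_inv c)).
      by case: (X_ck 1%N) => + _; apply.
    case: tr => + _; apply; exists (phi t); last exact: phiK.
    by split => //; exact: phi_dom.
  have dH : differentiable H (G t).
    case: tr' => + _; apply; exists (phi t) => //.
    by split => //; exact: phi_dom.
  have dP : differentiable (mulmxr P) (H (G t)).
    exact: mulmxr_differentiable.
  have dHG := differentiable_comp dG dH.
  (* (X s - a) *m P = s provides a smooth left inverse of G. *)
  have JE : 'J G t *m 'J H (G t) *m P = 1%:M.
    have := jacobian_comp dHG dP.
    rewrite jacobian_mulmx (jacobian_comp dG dH) => <-.
    (* Near [t] the composite is this translation of the identity, since [phi] stays in the domain
       of [c'] there. *)
    pose C s := a *m P + mulmxr (1%:M : 'M[R]_k) s.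
    have dl : differentiable (mulmxr (1%:M : 'M[R]_k)) t.
      exact: mulmxr_differentiable.
    have dC : differentiable C t by exact: (differentiableD (differentiable_cst _ _) dl).
    have nC : \forall s \near t, C s = (mulmxr P \o (H \o G)) s.
      near=> s'.
      have [bs c's] : V' s' by near: s'; exact: open_nbhs_nbhs.
      rewrite /C /= /H /G /= mulmx1 chart_mapK // phiK //.
      by rewrite -[X s'](subrK a) mulmxDl XP addrC.
    rewrite -(near_eq_jacobian nC dC).
    apply/row_matrixP => i; rewrite [LHS]rowE [RHS]rowE.
    apply: etrans (esym (deriveEjacobian _ dC)) _.
    apply: etrans (deriveD (derivable_cst _ _ _) (diff_derivable dl)) _.
    by rewrite derive_cst add0r (deriveEjacobian _ dl) jacobian_mulmx.
  apply/eqP; rewrite -/(row_free _); apply/row_freeP.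
  by exists ('J H (G t) *m P); rewrite mulmxA.
- split; last first.
    exists psi => [t bt|]; first by rewrite /psi phiK.
    have : phi @` ball 0 rho `<=` chart_dom c by move=> _ [t bt <-]; exact: phi_dom.
    move=> /continuous_subspaceW; apply.
    apply: (comp_within_continuous (f := chart_map c) (h := fun x => (x - a) *m P)).
      exact: chart_map_continuous.
    exact: mulP_cont.
  (* The open set [W] is the box where the [B]-coordinates have norm below [rho] and the
     [e]-coordinate below [r]; in it the zero of [h] is unique, so points of the section lie on the
     graph. *)
  exists (chart_dom c `&` chart_map c @^-1`
      ((fun x : 'rV[R]_(k + 1) => (x - a) *m P) @^-1` ball 0 rho `&`
       (fun x : 'rV[R]_(k + 1) => ((x - a) *m Q) 0 0) @^-1` ball 0 r)).
    apply: within_open_preimage; [exact: chart_dom_open | exact: chart_map_continuous |].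
    apply: openI; apply: open_comp; try exact: ball_open.
      by move=> x _; exact: mulP_cont.
    move=> x _.
    exact: (continuous_comp (mulP_cont _ Q x) (@coord_continuous _ _ _ 0 0 _)).
  apply/seteqP; split=> [_ [t bt <-]|y [Sy [cy /= [yP yQ]]]].
    have [sr _ _ hX] := sP t bt; split; first exact: hX.
    split; first exact: phi_dom.
    by split; rewrite /= phiK // ?XP // XQ -ball_normE /= sub0r normrN.
  pose x := chart_map c y; pose t := (x - a) *m P; pose z := ((x - a) *m Q) 0 0.
  have xE : a + t *m B + z *: e = x.
    have -> : z *: e = (x - a) *m Q *m e.
      by rewrite [(x - a) *m Q]mx11_scalar mul_scalar_mx.
    by rewrite /t -addrA -!mulmxA -mulmxDr PBQe mulmx1 addrC subrK.
  have zs : z = s t.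
    apply: s_uniq => //; first by move: yQ; rewrite -ball_normE /= sub0r normrN.
    by rewrite xE /h /f /= chart_mapK.
  exists t => //.
  by rewrite /phi /X -zs xE chart_mapK.
Unshelve. all: by end_near. Qed.

(** This holds for an arbitrary parametrization of the section, as the union of parabolas requires.
    Restricting to the part of [V] sent into the chart domain reduces it to the coordinate
    statements. *)
Lemma section_parametrization_forms V phi (t0 : 'rV[R]_k) :
  local_parametrization (section_preimage g q w) q V phi t0 ->
  w != 0 -> (w <= 'J f a)%MS ->
  let psi := chart_map c \o phi in
  ('J psi t0 :=: kermx ('J f a *m w^T))%MS /\
  forall v, let u := v *m 'J psi t0 in
    first_form (g \o phi) t0 v v = first_form f a u u /\
    second_form (orth w) (g \o phi) t0 v v = second_form 1%:M f a u u.
Proof.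
move=> [[oV Vt0 phi0] phi_cont phi_smooth phi_rank [[W oW phiV] _]] w0 wJ psi.
pose V' := V `&` phi @^-1` chart_dom c.
have oV' : open V' by exact: (within_open_preimage oV phi_cont (chart_dom_open c)).
have Vt0' : V' t0 by split=> //; rewrite /= phi0.
have VU t : V' t -> chart_cod c (psi t) by move=> [_ ct]; exists (phi t).
have psi_ck j : ck j V' psi by exact/CkE/phi_smooth.
have gE t : V' t -> (g \o phi) t = f (psi t).
  by move=> [_ ct]; rewrite /f /psi /= chart_mapK.
have psi0 : psi t0 = a by rewrite /psi /= phi0.
have fw t : V' t -> dotv (f (psi t) - f (psi t0)) w = 0.
  move=> Vt; rewrite psi0 fa -gE //.
  have : (phi @` V) (phi t) by exists t => //; case: Vt.
  by rewrite phiV => -[].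
have rP : \rank ('J psi t0) = k by apply: phi_rank => //; rewrite phi0.
have PK := section_tangent oU oV' Vt0' VU (f_ck 1) (psi_ck 1%N) fw rP.
have kE : k = (k + 1).-1 by rewrite addn1.
rewrite psi0 in PK; have {}PK := PK kE w0 wJ.
split=> // v.
have := section_forms v oU oV' Vt0' VU (f_ck 2) (psi_ck 2%N) gE w0.
by rewrite psi0; apply.
Qed.

End section_parametrization.

(** * The curvature locus as a union of curvature parabolas *)

Lemma exists_orthogonal_sub (R : realType) n m (A : 'M[R]_(n, m)) (d : 'rV[R]_m) :
  (1 < \rank A)%N -> exists w : 'rV[R]_m, [/\ w != 0, (w <= A)%MS & dotv d w = 0].
Proof.
move=> rA.
suff : (A :&: orth d)%MS != 0.
  move=> /rowV0Pn[w]; rewrite sub_capmx => /andP[wA wd] w0; exists w; split=> //.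
  by move: wd; rewrite sub_orth mul_tr_eq0 dotvC => /eqP.
rewrite -mxrank_eq0 -lt0n.
(* [A] has rank at least 2 and [orth d] at least [m - 1], while their sum has rank at most [m]. *)
have := mxrank_sum_cap A (orth d); rewrite mxrank_ker mxrank_tr.
have := rank_leq_col (A + orth d)%MS; have := rank_leq_row d.
lia.
Qed.

Theorem theorem3p3 (R : realType) (M : smooth_manifold R 3)
    (g : M -> 'rV[R]_5) (q : M) (c : chart R 3 M)
    (g_smooth : smooth_map g) (c_atlas : atlas c) (q_c : chart_dom c q)
    (g_corank1 : corank1 (g \o chart_inv c) (chart_map c q)) :
  curvature_locus 1%:M (g \o chart_inv c) (chart_map c q) =
  \bigcup_(w in [set w : 'rV[R]_5 | w != 0 /\
             (w <= tangent_space (g \o chart_inv c) (chart_map c q))%MS])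
    curvature_parabola g q w.
Proof.
apply/seteqP; split=> [_ [u /= u1 <-]|y [w [/= w0]]]; last first.
  (* Parabolas lie in the locus: the differential of the parametrization sends a unit [v] to a unit
     vector with the same second fundamental form. *)
  rewrite genmxE => wJ [V [phi [t0 [lp [v /= v1 <-]]]]].
  have [_ /(_ v)[E1 E2]] :=
    section_parametrization_forms (k := 2) g_smooth c_atlas q_c lp w0 wJ.
  by exists (v *m 'J (chart_map c \o phi) t0); rewrite /= -?E1 -?E2.
set f := g \o chart_inv c in u1 g_corank1 *; set a := chart_map c q in u1 g_corank1 *.
have [w [w0 wJ uw]] : exists w : 'rV[R]_5,
    [/\ w != 0, (w <= 'J f a)%MS & dotv (u *m 'J f a) w = 0].
  (* Corank 1 in dimension 3 means that the tangent space has rank 2, just enough for such a [w]. *)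
  by apply: exists_orthogonal_sub; rewrite g_corank1.
exists w; first by split=> //; rewrite genmxE.
have [V [phi [t0 lp]]] :=
  section_local_parametrization (k := 2) g_smooth c_atlas q_c w0 wJ.
exists V, phi, t0; split=> //.
have [PK forms] :=
  section_parametrization_forms (k := 2) g_smooth c_atlas q_c lp w0 wJ.
(* By the choice of [w], the vector [u] lies in the kernel that equals the tangent plane of the
   section, so it comes from a parameter vector [v]. *)
have /submxP[v uE] : (u <= 'J (chart_map c \o phi) t0)%MS.
  by rewrite PK; apply/sub_kermxP; rewrite mulmxA; apply/eqP; rewrite mul_tr_eq0 uw.
have [E1 E2] := forms v.
by exists v; rewrite /= ?E1 ?E2 -uE.
Qed.
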